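(* Let $p$ be an odd prime and $m$, $r$ two positive integers with $p\nmid m$, and let $x$, $q$ be indeterminates. Then $$\sum_{k=0}^{p-1}\frac{(q^r;q^m)_k (q^{m-r};q^m)_k x^k}{(q^m;q^m)_k^2} \equiv (-1)^{\langle -\frac{r}{m}\rangle_p} q^{\frac{-m\langle -\frac{r}{m}\rangle_p \left(\langle -\frac{r}{m}\rangle_p+1 \right)}{2}} \sum_{k=0}^{p-1}\frac{(q^r;q^m)_k (q^{m-r};q^m)_k (x;q^m)_k q^{mk}}{(q^m;q^m)_k^2} \pmod{[p]}.$$ In particular, if $p\equiv \pm 1\pmod m$, then $$\sum_{k=0}^{p-1}\frac{(q^r;q^m)_k (q^{m-r};q^m)_k x^k}{(q^m;q^m)_k^2} \equiv (-1)^{\langle -\frac{r}{m}\rangle_p}q^{\frac{r(m-r)(1-p^2)}{2m}} \sum_{k=0}^{p-1}\frac{(q^r;q^m)_k (q^{m-r};q^m)_k (x;q^m)_k q^{mk}}{(q^m;q^m)_k^2} \pmod{[p]}.$$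
   Context: $q$ is an indeterminate. $(a;q)_0=1$ and $(a;q)_n=(1-a)(1-aq)\cdots(1-aq^{n-1})$ for $n\ge 1$; so $(a;q^m)_n=\prod_{j=0}^{n-1}(1-aq^{mj})$. For a $p$-adic integer $a$ (e.g. $a=-r/m$ with $p\nmid m$), $\langle a\rangle_p$ denotes the least nonnegative residue of $a$ modulo $p$. $[p]=1+q+\cdots+q^{p-1}$, which is irreducible in $\mathbb{Q}[q]$ for $p$ prime. For rational functions $A(q),B(q)\in\mathbb{Q}(q)$ whose denominators are relatively prime to $[p]$, $A\equiv B\pmod{[p]}$ means that $A-B$ can be written as a fraction whose numerator is divisible by $[p]$ in $\mathbb{Q}[q]$ and whose denominator is relatively prime to $[p]$ (negative powers of $q$ are allowed). For polynomials in $x$ with such coefficients, congruence modulo $[p]$ means congruence of the coefficients of $x^k$ modulo $[p]$ for every $k$. *)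

(* Defs.v *)
From HB Require Import structures.
From mathcomp Require Import all_boot all_order all_algebra.

Set Implicit Arguments.
Unset Strict Implicit.
Unset Printing Implicit Defensive.

Import GRing.Theory.
Local Open Scope ring_scope.

(* The field Q(q); its indeterminate is the image of 'X : {poly rat}. *)
Definition Qq : fieldType := {fraction {poly rat}}.

Definition qvar : Qq := tofrac ('X : {poly rat}).

(* (a; b)_n = (1 - a) (1 - a b) ... (1 - a b^(n-1)) *)
Definition qpoch (R : comNzRingType) (a b : R) (n : nat) : R :=
  \prod_(j < n) (1 - a * b ^+ j).

(* [n] = 1 + q + ... + q^(n-1) *)
Definition qnat (n : nat) : {poly rat} := \sum_(i < n) 'X^i.

(* < a >_p for a prime p and a rational a whose denominator is prime to p:
   the representative in {0, ..., p-1} of the image of a in Z / p. *)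
Definition residue (p : nat) (a : rat) : nat := (ratr a : 'F_p).

(* A can be written with a denominator relatively prime to M. *)
Definition regular_mod (M : {poly rat}) (A : Qq) : Prop :=
  exists N D : {poly rat}, coprimep D M /\ A = tofrac N / tofrac D.

(* Congruence is only defined between elements regular modulo M, so both
   regularity conditions are part of the relation. *)
Definition qcong (M : {poly rat}) (A B : Qq) : Prop :=
  [/\ regular_mod M A, regular_mod M B &
      exists N D : {poly rat},
        [/\ M %| N, coprimep D M & A - B = tofrac N / tofrac D]].

Definition poly_qcong (M : {poly rat}) (F G : {poly Qq}) : Prop :=
  forall k : nat, qcong M F`_k G`_k.

(* The integer power qvar ^ (m - r) is negative when r > m. *)
Definition qcoef (m r k : nat) : Qq :=
  qpoch (qvar ^+ r) (qvar ^+ m) k *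
  qpoch (qvar ^ (m%:Z - r%:Z)) (qvar ^+ m) k /
  qpoch (qvar ^+ m) (qvar ^+ m) k ^+ 2.

(* The indeterminate x is 'X : {poly Qq}. *)
Definition lhs_sum (p m r : nat) : {poly Qq} :=
  \sum_(k < p) qcoef m r k *: 'X^k.

Definition rhs_sum (p m r : nat) : {poly Qq} :=
  \sum_(k < p)
    (qcoef m r k * qvar ^+ (m * k)%N) *: qpoch 'X (qvar ^+ m)%:P k.

(* Main.v *)
Require Import Defs.
From HB Require Import structures.
From mathcomp Require Import all_boot all_order all_algebra all_field.
From mathcomp Require Import ring zify.

Set Implicit Arguments.
Unset Strict Implicit.
Unset Printing Implicit Defensive.

Import GRing.Theory Num.Theory.
Local Open Scope ring_scope.

(** Modulo [p] the variable q becomes a primitive p-th root of unity zeta: the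
    polynomial [p] is the p-th cyclotomic polynomial, so it is the minimal
    polynomial of zeta over the rationals, and a congruence modulo [p] between
    regular rational functions says that both take the same value at zeta
    ([qnat_dvdp], [reduces_qcong]).

    Put Q = zeta^m, again of order p since p does not divide m, and let a be
    the residue of -r/m, so that p divides r + m a ([residueP]).  Then
    zeta^r = Q^(-a) and zeta^(m-r) = Q^(a+1): the summation coefficients become
    those of the little q-Legendre polynomial of degree a, which vanish beyond
    k = a, and the theorem becomes the identity [qlegendre_expansion]
      sum_k w_k x^k = (-1)^a Q^(-a(a+1)/2) sum_k w_k Q^k (x;Q)_k,
      w_k = (Q^(-a);Q)_k (Q^(a+1);Q)_k / (Q;Q)_k^2.
    To prove it, compare coefficients of x^j.  On the right, expand (x;Q)_k by
    the q-binomial theorem ([coef_qpochX]); the sum over k >= j is then a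
    terminating 2phi1 at Q with upper parameters Q^(j-a), Q^(a+1+j) and lower
    parameter Q^(j+1), which the q-Chu-Vandermonde formula
    ([qChuVandermonde]) evaluates as a product; that product is a signed power
    of Q because its numerator, read backwards and stripped of such factors, is
    its denominator.  All of this divides only by powers of Q and by 1 - Q^i
    with 0 < i < p, so it holds at a root of unity.

    Only the value of q^e at zeta matters, that is e modulo p.  Since m a = -r
    modulo p,
      - m a (a + 1) / 2 = - (m a) (m a + m) / (2 m) = r (m - r) / (2 m)
    modulo p, which is why the second exponent may replace the first
    ([dvd_exponent_pm1]). *)

(** * Shifted factorials over a field *)

Lemma qpochS (R : comNzRingType) (a b : R) n :
  qpoch a b n.+1 = qpoch a b n * (1 - a * b ^+ n).
Proof. by rewrite /qpoch big_ord_recr. Qed.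

Lemma qpochSl (R : comNzRingType) (a b : R) n :
  qpoch a b n.+1 = (1 - a) * qpoch (a * b) b n.
Proof.
rewrite /qpoch big_ord_recl expr0 mulr1; congr (_ * _).
by apply: eq_bigr => i _; rewrite exprS mulrA.
Qed.

Lemma qpochD (R : comNzRingType) (a b : R) k l :
  qpoch a b (k + l) = qpoch a b k * qpoch (a * b ^+ k) b l.
Proof.
rewrite /qpoch big_split_ord /=; congr (_ * _).
by apply: eq_bigr => i _; rewrite exprD mulrA.
Qed.

Lemma qpoch_neq0 (F : fieldType) (a b : F) n :
  (forall i, (i < n)%N -> a * b ^+ i != 1) -> qpoch a b n != 0.
Proof.
by move=> nz; apply/prodf_neq0 => i _; rewrite subr_eq0 eq_sym nz.
Qed.

Lemma qpoch_eq0 (F : fieldType) (a b : F) i n :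
  (i < n)%N -> a * b ^+ i = 1 -> qpoch a b n = 0.
Proof.
move=> lt_in ab1; apply/eqP/prodf_eq0; exists (Ordinal lt_in) => //.
by rewrite ab1 subrr.
Qed.

Lemma bin2D k l : 'C(k + l, 2) = ('C(k, 2) + k * l + 'C(l, 2))%N.
Proof.
elim: l => [|l IH]; first by rewrite addn0 muln0 !addn0.
by rewrite addnS !binS !bin1 IH; lia.
Qed.

(** * The q-binomial theorem *)

Lemma size_qpochX (F : fieldType) (Q : F) k :
  (size (qpoch 'X Q%:P k) <= k.+1)%N.
Proof.
elim: k => [|k IH]; first by rewrite /qpoch big_ord0 size_poly1.
have arith s t : (s <= k.+1 -> t <= 2 -> (s + t).-1 <= k.+2)%N by lia.
rewrite qpochS; apply: leq_trans (size_polyMleq _ _) _; apply: arith => //.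
rewrite (leq_trans (size_polyD _ _)) // geq_max size_poly1 size_polyN /=.
by rewrite -polyC_exp mulrC mul_polyC (leq_trans (size_scale_leq _ _)) ?size_polyX.
Qed.

(** The q-binomial theorem: the right-hand side is
    (-1)^j Q^(j(j-1)/2) times the Gaussian binomial [j+l choose j], written with
    the common factor (Q;Q)_j of numerator and denominator cancelled.  It is
    the q-Pascal recurrence obtained from the last factor 1 - x Q^(j+l-1). *)
Lemma coef_qpochX (F : fieldType) (Q : F) j l :
    (forall i, (0 < i <= j + l)%N -> Q ^+ i != 1) ->
  (qpoch 'X Q%:P (j + l))`_j =
    (-1) ^+ j * Q ^+ 'C(j, 2) * qpoch (Q * Q ^+ j) Q l / qpoch Q Q l.
Proof.
have coefS k i : (qpoch 'X Q%:P k.+1)`_i =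
    (qpoch 'X Q%:P k)`_i - Q ^+ k * (if i is i'.+1 then (qpoch 'X Q%:P k)`_i' else 0).
  rewrite qpochS mulrBr mulr1 coefB mulrA -polyC_exp coefMC coefMX mulrC.
  by case: i.
move=> nz; have [n def_n] := ubnP (j + l); elim: n j l def_n nz => // n IH [|j] [|l] lt_n nz.
- by rewrite /qpoch !big_ord0 coef1 !mulr1 divr1.
- rewrite add0n coefS mulr0 subr0 -[l]add0n IH; last 2 first.
  + lia.
  + by move=> i ?; apply: nz; lia.
  have nz' k : (k <= l.+1)%N -> qpoch Q Q k != 0.
    by move=> ?; apply: qpoch_neq0 => i ?; rewrite -exprS nz //; lia.
  by rewrite !expr0 !mulr1 !mul1r !divff ?nz' //; lia.
- rewrite addn0 coefS nth_default ?size_qpochX // sub0r.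
  rewrite -{2}[j]addn0 IH; last 2 first.
  + lia.
  + by move=> i ?; apply: nz; lia.
  rewrite /qpoch !big_ord0 !mulr1 !invr1 !mulr1 binS bin1 exprD exprS; ring.
rewrite addnS coefS IH; last 2 first.
- lia.
- by move=> i ?; apply: nz; lia.
rewrite addSnnS IH; last 2 first.
- lia.
- by move=> i ?; apply: nz; lia.
have nzl : qpoch Q Q l != 0.
  by apply: qpoch_neq0 => i ?; rewrite -exprS nz //; lia.
have nzS : 1 - Q * Q ^+ l != 0 by rewrite subr_eq0 eq_sym -exprS nz //; lia.
rewrite [qpoch Q Q l.+1]qpochS [qpoch (Q * Q ^+ j.+1) Q l.+1]qpochS.
rewrite [qpoch _ _ l.+1]qpochSl -[Q * Q ^+ j * Q]mulrA -exprSr.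
rewrite binS bin1 addnS !exprS !exprD.
by field; rewrite nzl nzS.
Qed.

(** * The q-Chu-Vandermonde summation *)

(** Induction on n.  Since
      (Q^(-n-1);Q)_k - (Q^(-n);Q)_k = - Q^(-n-1) (1 - Q^k) (Q^(-n);Q)_(k-1),
    the sum S_n(b, c) satisfies
      S_(n+1)(b, c) = S_n(b, c) - Q^(-n) (1 - b)/(1 - c) S_n(b Q, c Q),
    and the product obeys the same recurrence because
      (1 - c Q^n) - (1 - b) = b - c Q^n. *)
Lemma qChuVandermonde (F : fieldType) (Q b c : F) n :
    Q != 0 -> (forall i, (0 < i <= n)%N -> Q ^+ i != 1) ->
    (forall i, (i < n)%N -> c * Q ^+ i != 1) ->
  \sum_(k < n.+1) qpoch (Q ^- n) Q k * qpoch b Q k * Q ^+ k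
                    / (qpoch Q Q k * qpoch c Q k)
  = \prod_(j < n) ((b - c * Q ^+ j) / (1 - c * Q ^+ j)).
Proof.
move=> Q0; elim: n b c => [|n IH] b c Qn cn.
  by rewrite big_ord_recl /qpoch !big_ord0 expr0 !mulr1 invr1 addr0 mulr1.
have Qn' i : (0 < i <= n)%N -> Q ^+ i != 1 by move=> ?; apply: Qn; lia.
have c1 : 1 - c != 0 by rewrite subr_eq0 eq_sym -[c]mulr1 -(expr0 Q) cn.
pose v B C k := qpoch (Q ^- n) Q k * qpoch B Q k * Q ^+ k
                    / (qpoch Q Q k * qpoch C Q k).
have vS k : (k <= n)%N ->
    qpoch (Q ^- n.+1) Q k.+1 * qpoch b Q k.+1 * Q ^+ k.+1
      / (qpoch Q Q k.+1 * qpoch c Q k.+1)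
    = v b c k.+1 - Q ^- n * ((1 - b) / (1 - c)) * v (b * Q) (c * Q) k.
  move=> le_kn; rewrite /v [qpoch (Q ^- n) _ _]qpochS.
  have -> : qpoch (Q ^- n.+1) Q k.+1 = (1 - Q ^- n.+1) * qpoch (Q ^- n) Q k.
    by rewrite qpochSl exprS invfM mulrAC mulVf // mul1r.
  rewrite ![qpoch b _ _]qpochSl ![qpoch c _ _]qpochSl [qpoch Q Q k.+1]qpochS.
  have nzl : qpoch Q Q k != 0.
    by apply: qpoch_neq0 => i ?; rewrite -exprS Qn //; lia.
  have nzS : 1 - Q * Q ^+ k != 0 by rewrite subr_eq0 eq_sym -exprS Qn //; lia.
  have nzc : qpoch (c * Q) Q k != 0.
    by apply: qpoch_neq0 => i ?; rewrite -mulrA -exprS cn //; lia.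
  rewrite !exprS.
  by field; rewrite nzl nzS nzc c1 expf_neq0 // Q0.
rewrite [LHS]big_ord_recl.
under eq_bigr => k _ do rewrite lift0 (vS _ (leq_ord k)).
rewrite sumrB -mulr_sumr IH //; last first.
  by move=> i ?; rewrite -mulrA -exprS cn //; lia.
have -> : qpoch (Q ^- n.+1) Q 0 * qpoch b Q 0 * Q ^+ 0
    / (qpoch Q Q 0 * qpoch c Q 0) = v b c 0%N by rewrite /v /qpoch !big_ord0.
rewrite addrA.
have -> : v b c 0%N + \sum_(i < n.+1) v b c i.+1 =
    \prod_(j < n) ((b - c * Q ^+ j) / (1 - c * Q ^+ j)).
  rewrite -(IH b c) // => [|i ?]; last by apply: cn; lia.
  (* The term of index n + 1 vanishes, as (Q^(-n);Q)_(n+1) = 0. *)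
  rewrite big_ord_recr /= [RHS]big_ord_recl addrA.
  rewrite [X in _ + X](_ : _ = 0) ?addr0 // /v.
  by rewrite (@qpoch_eq0 _ _ _ n) ?mul0r // mulVf // expf_neq0.
rewrite !prodf_div.
have numE : \prod_(j < n) (b * Q - c * Q * Q ^+ j) =
    Q ^+ n * \prod_(j < n) (b - c * Q ^+ j).
  rewrite (eq_bigr (fun j : 'I_n => Q * (b - c * Q ^+ j))) => [|j _]; last by ring.
  by rewrite big_split /= prodr_const card_ord.
have denE : (1 - c) * \prod_(j < n) (1 - c * Q * Q ^+ j) =
    \prod_(j < n) (1 - c * Q ^+ j) * (1 - c * Q ^+ n).
  by have := qpochSl c Q n; rewrite qpochS.
have nz1 : \prod_(j < n) (1 - c * Q ^+ j) != 0.
  by apply: (@qpoch_neq0 _ c Q n) => i ?; apply: cn; lia.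
have nz2 : 1 - c * Q ^+ n != 0 by rewrite subr_eq0 eq_sym cn.
have nz3 : \prod_(j < n) (1 - c * Q * Q ^+ j) != 0.
  by apply: (@qpoch_neq0 _ (c * Q) Q n) => i ?; rewrite -mulrA -exprS cn.
rewrite numE !big_ord_recr /=.
set N := \prod_(_ < _) (b - _) in numE *.
set D := \prod_(_ < _) (1 - c * Q ^+ _) in denE nz1 *.
have -> : \prod_(j < n) (1 - c * Q * Q ^+ j) = D * (1 - c * Q ^+ n) / (1 - c).
  by rewrite -denE mulrAC divff // mul1r.
by field; rewrite nz1 nz2 c1 expf_neq0.
Qed.

(** * An expansion of the little q-Legendre polynomials *)

(** The coefficient of x^k in the little q-Legendre polynomial of degree n, up
    to the normalization of its argument: x here stands for Q times the
    customary variable. *)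
Definition qlegendre (F : fieldType) (Q : F) n k : F :=
  qpoch (Q ^- n) Q k * qpoch (Q ^+ n.+1) Q k / qpoch Q Q k ^+ 2.

(** The value of the Chu-Vandermonde product that occurs in the expansion.  The
    factor of index i in the numerator is - Q^(j+1+i) (1 - Q^(j+l-i)), and the
    exponents j + l - i are those of the denominator in reverse order. *)
Lemma prod_qlegendre (F : fieldType) (Q : F) j l :
    (forall i, (0 < i <= j + l)%N -> Q ^+ i != 1) ->
  \prod_(i < l) ((Q ^+ ((j + l).+1 + j) - Q ^+ j.+1 * Q ^+ i)
                    / (1 - Q ^+ j.+1 * Q ^+ i))
  = (-1) ^+ l * Q ^+ (j.+1 * l + 'C(l, 2)).
Proof.
move=> Qi; have nzP : \prod_(i < l) (1 - Q ^+ j.+1 * Q ^+ i) != 0.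
  by apply: (@qpoch_neq0 _ (Q ^+ j.+1) Q l) => i ?; rewrite -exprD Qi //; lia.
rewrite prodf_div; apply: (canLR (mulfK nzP)).
rewrite [X in _ * X](reindex_inj rev_ord_inj) /=.
rewrite (eq_bigr (fun i : 'I_l =>
  - Q ^+ j.+1 * Q ^+ i * (1 - Q ^+ j.+1 * Q ^+ (l - i.+1)))) => [|i _].
  rewrite !big_split /= prodr_const card_ord [(- Q ^+ _) ^+ _]exprNn -exprM.
  by rewrite exprD -bin2_sum big_mkord expr_sum mulrA.
have lt_il := ltn_ord i.
have -> : ((j + l).+1 + j = j.+1 + i + (j.+1 + (l - i.+1)))%N by lia.
by rewrite !exprD; ring.
Qed.

(** The sums may run to any N > n since the coefficients vanish beyond n; the
    powers Q^i are only required to differ from 1 up to n, so that Q may be a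
    root of unity. *)
Lemma qlegendre_expansion (F : fieldType) (Q : F) n N :
    (n < N)%N -> Q != 0 -> (forall i, (0 < i <= n)%N -> Q ^+ i != 1) ->
  \sum_(k < N) qlegendre Q n k *: 'X^k =
    ((-1) ^+ n * Q ^- 'C(n.+1, 2)) *:
       \sum_(k < N) (qlegendre Q n k * Q ^+ k) *: qpoch 'X Q%:P k.
Proof.
move=> lt_nN Q0 Qn.
have w0 k : (n < k)%N -> qlegendre Q n k = 0.
  move=> lt_nk; rewrite /qlegendre (@qpoch_eq0 _ _ _ n) ?mul0r //.
  by rewrite mulVf // expf_neq0.
have trunc (G : nat -> {poly F}) : (forall k, (n < k)%N -> G k = 0) ->
    \sum_(k < N) G k = \sum_(k < n.+1) G k.
  move=> G0; rewrite (big_ord_widen _ G lt_nN) [RHS]big_mkcond /=.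
  by apply: eq_bigr => k _; case: ltnP => // /G0.
rewrite (trunc (fun k => qlegendre Q n k *: 'X^k)) => [|k /w0->]; last by rewrite scale0r.
rewrite (trunc (fun k => (qlegendre Q n k * Q ^+ k) *: qpoch 'X Q%:P k)) => [|k /w0->];
  last by rewrite mul0r scale0r.
apply/polyP => j; rewrite coefZ !coef_sum.
under eq_bigr do rewrite coefZ coefXn.
under [in RHS]eq_bigr do rewrite coefZ.
have [lt_nj|le_jn] := ltnP n j.
  rewrite !big1 ?mulr0 // => k _; first by rewrite nth_default ?mulr0 //
    (leq_trans (size_qpochX _ _)) //; have := ltn_ord k; lia.
  by case: eqP (ltn_ord k) => [<-|_]; [lia | rewrite mulr0].
rewrite (bigD1 (inord j)) //= inordK // eqxx mulr1 big1 ?addr0; last first.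
  move=> k /eqP nk; case: eqP => [jk|]; rewrite ?mulr0 //.
  by case: nk; apply: val_inj; rewrite /= inordK.
have [l def_n] : exists l, n = (j + l)%N by exists (n - j)%N; lia.
rewrite -(big_mkord xpredT (fun k => qlegendre Q n k * Q ^+ k * (qpoch 'X Q%:P k)`_j)).
rewrite (@big_cat_nat _ _ _ j) //=; last lia.
rewrite big_nat_cond big1 ?add0r; last first.
  by move=> k ?; rewrite nth_default ?mulr0 // (leq_trans (size_qpochX _ _)) //; lia.
rewrite -[X in \big[_/_]_(X <= _ < _) _]add0n big_addn big_mkord.
have -> : (n.+1 - j)%N = l.+1 by lia.
have nzQ k : (k <= n)%N -> qpoch Q Q k != 0.
  by move=> ?; apply: qpoch_neq0 => i ?; rewrite -exprS Qn //; lia.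
(* Shifting k by j turns the right-hand side into the term at j times the
   Chu-Vandermonde sum with n - j, Q^(n+1+j), Q^(j+1) for n, b, c. *)
transitivity ((-1) ^+ n * Q ^- 'C(n.+1, 2) * (qlegendre Q n j * Q ^+ j * (-1) ^+ j * Q ^+ 'C(j, 2) *
   \prod_(i < l) ((Q ^+ (n.+1 + j) - Q ^+ j.+1 * Q ^+ i) / (1 - Q ^+ j.+1 * Q ^+ i)))).
  have := @prod_qlegendre F Q j l; rewrite -def_n => /(_ Qn) ->.
  have -> : 'C(n.+1, 2) = (j + 'C(j, 2) + (j.+1 * l + 'C(l, 2)))%N.
    by rewrite binS bin1 def_n bin2D; lia.
  have s2 : (-1 : F) ^+ n * (-1) ^+ j * (-1) ^+ l = 1.
    by rewrite -!exprD def_n -signr_odd; have -> : odd (j + l + j + l) = false by lia.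
  transitivity (qlegendre Q n j * ((-1) ^+ n * (-1) ^+ j * (-1) ^+ l)).
    by rewrite s2 mulr1.
  rewrite !exprD !invfM.
  by field; rewrite !expf_neq0.
congr (_ * _).
rewrite -qChuVandermonde //; last 2 first.
- by move=> i ?; apply: Qn; lia.
- by move=> i ?; rewrite -exprD; apply: Qn; lia.
rewrite mulr_sumr; apply: eq_bigr => k _; have := ltn_ord k => lt_kl.
rewrite [(k + j)%N]addnC coef_qpochX; last by move=> i ?; apply: Qn; lia.
rewrite /qlegendre !qpochD -exprS -exprD.
have -> : Q ^- n * Q ^+ j = Q ^- l.
  by rewrite def_n exprD invfM mulrAC mulVf ?mul1r // expf_neq0.
have nz1 := nzQ j le_jn.
have nz2 : qpoch Q Q k != 0 by apply: nzQ; lia.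
have nz3 : qpoch (Q ^+ j.+1) Q k != 0.
  by apply: qpoch_neq0 => i ?; rewrite -exprD Qn //; lia.
by rewrite [Q ^+ (j + k)]exprD; field; rewrite nz1 nz2 nz3.
Qed.

(** * The residue of -r/m *)

(** The residue is computed from the reduced fraction n/d of -r/m, whereas the
    congruence is about r and m: n m = - r d holds over the integers, and p
    does not divide d because it divides neither m nor both of n and d. *)
Lemma residueP p m r : prime p -> ~~ (p %| m)%N ->
  (p %| r + m * residue p (- (r%:R / m%:R)))%N.
Proof.
move=> p_pr p_m; set x : rat := - _.
have m0 : (m%:R : rat) != 0 by rewrite pnatr_eq0; apply: contraNneq p_m => ->.
have nmE : numq x * m%:Z = - (r%:Z * denq x).
  apply: (@intr_inj rat); rewrite rmorphM rmorphN rmorphM /=.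
  have := divq_num_den x; rewrite {3}/x => dx.
  have d0 : ((denq x)%:~R : rat) != 0 by rewrite intr_eq0 denq_neq0.
  have /(congr1 ( *%R^~ ((denq x)%:~R * m%:R))) := dx.
  rewrite mulrA divfK // => ->.
  by rewrite -!pmulrn; field.
have dF : ((denq x)%:~R : 'F_p) != 0.
  have := denq_gt0 x; case E: (denq x) => [d|//] _.
  rewrite -pmulrn -(dvdn_pcharf (pchar_Fp p_pr)); apply/negP => pd.
  have : (p %| `|numq x| * m)%N.
    have -> : (`|numq x| * m = `|(numq x * m%:Z)%R|)%N by rewrite abszM.
    by rewrite nmE E abszN abszM dvdn_mull.
  rewrite Euclid_dvdM // (negPf p_m) orbF => pn.
  have := coprime_num_den x; rewrite E => /eqP g1.
  have : (p %| 1)%N by rewrite -g1 dvdn_gcd pn.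
  by rewrite dvdn1; case: eqP p_pr => // ->.
rewrite (dvdn_pcharf (pchar_Fp p_pr)) natrD natrM natr_Zp /ratr.
have /(congr1 (fun z : int => z%:~R : 'F_p)) := nmE.
rewrite /= rmorphM rmorphN rmorphM /= -!pmulrn => nmF.
by rewrite mulrCA mulrA nmF mulNr mulfK // subrr.
Qed.

Lemma residue_lt p x : prime p -> (residue p x < p)%N.
Proof. by move=> p_pr; have := ltn_ord (ratr x : 'F_p); rewrite {2}Fp_cast. Qed.

(** * Reduction modulo [p] as evaluation at a root of unity *)

Lemma Cyclotomic_prime p : prime p -> 'Phi_p = \sum_(i < p) 'X^i.
Proof.
move=> p_pr; have p_gt1 := prime_gt1 p_pr.
have X1 : 'Phi_1 = 'X - 1 :> {poly int}.
  by rewrite -['X]expr1 -(@prod_Cyclotomic 1) // big_seq1.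
have := @prod_Cyclotomic p (ltnW p_gt1).
rewrite (perm_big [:: 1%N; p]) /=; last first.
  apply: uniq_perm; rewrite ?divisors_uniq //=.
    by rewrite andbT mem_seq1 neq_ltn p_gt1.
  move=> d; rewrite -dvdn_divisors ?(ltnW p_gt1) // !inE.
  apply/idP/orP => [dvd_dp|[] /eqP -> //].
  by case/primeP: p_pr => _ /(_ d dvd_dp)/orP.
rewrite big_cons big_seq1 subrX1 X1.
by apply: mulfI; rewrite polyXsubC_eq0.
Qed.

Section ResidueField.

Variables (p : nat) (zeta : algC).
Hypotheses (p_pr : prime p) (zetaP : p.-primitive_root zeta).

Lemma zeta_neq0 : zeta != 0.
Proof.
apply: contra_eq_neq (prim_expr_order zetaP) => ->.
by rewrite expr0n gtn_eqF ?prime_gt0 // eq_sym oner_eq0.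
Qed.

Lemma zeta_exprz_eq1 (k : int) : (p %| k)%Z -> zeta ^ k = 1.
Proof.
by case/dvdzP=> t ->; rewrite mulrC -exprz_exp -exprnP prim_expr_order // exp1rz.
Qed.

Definition at_root (N : {poly rat}) : algC := (map_poly ratr N).[zeta].

Lemma at_rootM N D : at_root (N * D) = at_root N * at_root D.
Proof. by rewrite /at_root rmorphM hornerM. Qed.

Lemma at_rootD N D : at_root (N + D) = at_root N + at_root D.
Proof. by rewrite /at_root rmorphD hornerD. Qed.

Lemma at_rootN N : at_root (- N) = - at_root N.
Proof. by rewrite /at_root rmorphN hornerN. Qed.

Lemma at_root1 : at_root 1 = 1.
Proof. by rewrite /at_root rmorph1 hornerC. Qed.

(** [p] is the minimal polynomial of zeta. *)
Lemma qnat_dvdp N : (qnat p %| N) = (at_root N == 0).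
Proof.
have [f [fE f_monic fP]] := minCpolyP zeta.
have phiE : map_poly (ratr : rat -> algC) (qnat p) = map_poly ratr f.
  rewrite -fE (minCpoly_cyclotomic zetaP) -(Cintr_Cyclotomic zetaP).
  rewrite Cyclotomic_prime // /qnat !rmorph_sum /=.
  by apply: eq_bigr => i _; rewrite !map_polyXn.
by rewrite (map_poly_inj _ phiE) -fP.
Qed.

(** As [p] is irreducible, the local ring at [p] consists of the fractions
    whose denominator does not vanish at zeta. *)
Lemma coprimep_qnat D : coprimep D (qnat p) = (at_root D != 0).
Proof.
have qnat0 : qnat p != 0.
  apply/eqP => q0; have := size_XnsubC (1 : rat) (prime_gt0 p_pr).
  by rewrite polyC1 subrX1 -/(qnat p) q0 mulr0 size_poly0.
apply/idP/idP => [/coprimepP cop|nzD]; last first.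
  apply/coprimepP => d /dvdpP[e De] /dvdpP[h qE].
  have := qnat_dvdp (qnat p).
  rewrite dvdpp qE at_rootM => /esym; move: nzD; rewrite De at_rootM mulf_eq0.
  rewrite mulf_eq0 negb_or => /andP[_ /negPf->]; rewrite orbF -qnat_dvdp.
  move/dvdpP=> [u hE]; rewrite -size_poly_eq1 -dvdp1; apply/dvdpP; exists u.
  apply: (mulIf qnat0); rewrite mul1r {1}qE hE; ring.
apply: contraT; rewrite negbK -qnat_dvdp => dvd.
have /eqp_dvdl := cop _ dvd (dvdpp _).
by move=> /(_ 1); rewrite dvdpp qnat_dvdp at_root1 oner_eq0.
Qed.

(** A relation rather than a function: it records at once that A lies in the
    local ring at [p] and that z is its image in the residue field, so that the
    closure properties below give regularity along with the value. *)
Definition reduces (A : Qq) (z : algC) :=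
  exists N D, [/\ at_root D != 0, A = tofrac N / tofrac D
                & z = at_root N / at_root D].

Lemma tofrac_neq0 D : at_root D != 0 -> (tofrac D : Qq) != 0.
Proof.
rewrite tofrac_eq0; apply: contraNneq => ->.
by rewrite /at_root rmorph0 horner0.
Qed.

Lemma reducesD A B y z : reduces A y -> reduces B z -> reduces (A + B) (y + z).
Proof.
move=> [N [D [D0 -> ->]]] [N' [D' [D0' -> ->]]].
exists (N * D' + N' * D), (D * D').
by rewrite at_rootD !at_rootM mulf_neq0 // rmorphD !rmorphM !addf_div ?tofrac_neq0.
Qed.

Lemma reducesM A B y z : reduces A y -> reduces B z -> reduces (A * B) (y * z).
Proof.
move=> [N [D [D0 -> ->]]] [N' [D' [D0' -> ->]]].
by exists (N * N'), (D * D'); rewrite !at_rootM mulf_neq0 // !rmorphM /= !mulf_div.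
Qed.

Lemma reducesV A z : z != 0 -> reduces A z -> reduces A^-1 z^-1.
Proof.
move=> z0 [N [D [D0 -> zE]]]; exists D, N; rewrite zE !invf_div; split=> //.
by apply: contraNneq z0 => N0; rewrite zE N0 mul0r.
Qed.

Lemma reduces_tofrac N : reduces (tofrac N) (at_root N).
Proof. by exists N, 1; rewrite at_root1 oner_neq0 rmorph1 !divr1. Qed.

Lemma reduces0 : reduces 0 0.
Proof.
have := reduces_tofrac 0.
by rewrite rmorph0 /at_root rmorph0 horner0.
Qed.

Lemma reduces1 : reduces 1 1.
Proof. by have := reduces_tofrac 1; rewrite rmorph1 at_root1. Qed.

Lemma reducesN A z : reduces A z -> reduces (- A) (- z).
Proof.
move=> Az; rewrite -mulN1r -[- z]mulN1r; apply: reducesM => //.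
by have := reduces_tofrac (- 1); rewrite rmorphN rmorph1 at_rootN at_root1.
Qed.

Lemma reducesX A z n : reduces A z -> reduces (A ^+ n) (z ^+ n).
Proof.
by move=> Az; elim: n => [|n IH]; [apply: reduces1 | rewrite !exprS; apply: reducesM].
Qed.

Lemma reduces_qvar : reduces qvar zeta.
Proof.
by have := reduces_tofrac 'X; rewrite /at_root map_polyX hornerX.
Qed.

Lemma reduces_qvarz (e : int) : reduces (qvar ^ e) (zeta ^ e).
Proof.
case: e => n; first exact/reducesX/reduces_qvar.
rewrite !NegzE; apply: reducesV; last exact/reducesX/reduces_qvar.
by rewrite expf_neq0 // zeta_neq0.
Qed.

Lemma reduces_qpoch A B y z n :
  reduces A y -> reduces B z -> reduces (qpoch A B n) (qpoch y z n).
Proof.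
move=> Ay Bz; apply: (big_ind2 reduces) => [|????|i _]; first exact: reduces1.
  exact: reducesM.
by apply: reducesD (reduces1) (reducesN _); apply: reducesM (reducesX _ _).
Qed.

Lemma reduces_regular A z : reduces A z -> regular_mod (qnat p) A.
Proof.
by move=> [N [D [D0 -> _]]]; exists N, D; rewrite coprimep_qnat.
Qed.

Lemma reduces_qcong A B z : reduces A z -> reduces B z -> qcong (qnat p) A B.
Proof.
move=> Az Bz; split; [exact: reduces_regular Az | exact: reduces_regular Bz|].
have [N [D [D0 -> NE]]] := reducesD Az (reducesN Bz).
exists N, D; rewrite qnat_dvdp coprimep_qnat; split=> //.
by have /eqP := NE; rewrite subrr eq_sym mulf_eq0 invr_eq0 (negPf D0) orbF.
Qed.

Definition poly_reduces (F : {poly Qq}) (f : {poly algC}) :=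
  forall k, reduces F`_k f`_k.

Lemma reduces_sum (I : finType) (A : I -> Qq) (z : I -> algC) :
  (forall i, reduces (A i) (z i)) -> reduces (\sum_i A i) (\sum_i z i).
Proof.
move=> Az; apply: (big_ind2 reduces) => [|????|i _ //]; first exact: reduces0.
exact: reducesD.
Qed.

Lemma poly_reduces_sum (I : finType) (F : I -> {poly Qq}) (f : I -> {poly algC}) :
  (forall i, poly_reduces (F i) (f i)) ->
  poly_reduces (\sum_i F i) (\sum_i f i).
Proof. by move=> Ff k; rewrite !coef_sum; apply: reduces_sum => i; apply: Ff. Qed.

Lemma poly_reducesM F G f g :
  poly_reduces F f -> poly_reduces G g -> poly_reduces (F * G) (f * g).
Proof.
by move=> Ff Gg k; rewrite !coefM; apply: reduces_sum => i; apply: reducesM.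
Qed.

Lemma poly_reducesZ A F z f :
  reduces A z -> poly_reduces F f -> poly_reduces (A *: F) (z *: f).
Proof. by move=> Az Ff k; rewrite !coefZ; apply: reducesM. Qed.

Lemma poly_reducesXn n : poly_reduces 'X^n 'X^n.
Proof.
by move=> k; rewrite !coefXn; case: eqP => _; [apply: reduces1 | apply: reduces0].
Qed.

Lemma poly_reduces_qpochX B z n :
  reduces B z -> poly_reduces (qpoch 'X B%:P n) (qpoch 'X z%:P n).
Proof.
have factorE (R : comNzRingType) (b : R) i :
    1 - 'X * b%:P ^+ i = 'X^0 - b ^+ i *: 'X^1 :> {poly R}.
  by rewrite expr0 expr1 -polyC_exp mulrC mul_polyC.
move=> Bz; apply: (big_ind2 poly_reduces) => [|????|i _ k].
- by rewrite -!(expr0 'X); apply: poly_reducesXn.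
- exact: poly_reducesM.
rewrite !factorE !coefB; apply: reducesD (reducesN _); first exact: poly_reducesXn.
by apply: poly_reducesZ (poly_reducesXn _) _; apply: reducesX.
Qed.

(** The congruence for any exponent e such that zeta^e = Q^(-a(a+1)/2); both
    exponents of the theorem qualify. *)
Lemma qlegendre_qcong m r a (e : int) :
    ~~ (p %| m)%N -> (a < p)%N -> (p %| r + m * a)%N ->
    (p %| e + m%:Z * 'C(a.+1, 2)%:Z)%Z ->
  poly_qcong (qnat p) (lhs_sum p m r)
    (((-1) ^+ a * qvar ^ e) *: rhs_sum p m r).
Proof.
move=> p_m lt_ap p_ra p_e; pose Q := zeta ^+ m.
have Q0 : Q != 0 by rewrite expf_neq0 ?zeta_neq0.
have Qi i : (0 < i < p)%N -> Q ^+ i != 1.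
  case/andP=> i0 ip; rewrite -exprM -(prim_order_dvd zetaP) Euclid_dvdM //.
  by rewrite negb_or p_m gtnNdvd.
have Qr : zeta ^+ r = Q ^- a.
  have Qa0 := expf_neq0 a Q0; apply: (mulIf Qa0); rewrite mulVf //.
  by rewrite -exprM -exprD; apply/eqP; rewrite -(prim_order_dvd zetaP).
have Qmr : zeta ^ (m%:Z - r%:Z) = Q ^+ a.+1.
  by rewrite expfzDr ?zeta_neq0 // -invr_expz -!exprnP Qr invrK -/Q -exprS.
have Qe : zeta ^ e = Q ^- 'C(a.+1, 2).
  have Qa0 := expf_neq0 'C(a.+1, 2) Q0; apply: (mulIf Qa0); rewrite mulVf //.
  by rewrite -exprM exprnP PoszM -expfzDr ?zeta_neq0 ?zeta_exprz_eq1.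
have coefR k : (k < p)%N -> reduces (qcoef m r k) (qlegendre Q a k).
  move=> lt_kp; have Qm := reducesX m reduces_qvar; rewrite -/Q in Qm.
  rewrite /qlegendre -Qr -Qmr; apply: reducesM.
    apply: reducesM; apply: reduces_qpoch => //; first exact/reducesX/reduces_qvar.
    exact: reduces_qvarz.
  apply: reducesV; last exact/reducesX/reduces_qpoch.
  rewrite expf_neq0 //; apply: qpoch_neq0 => i ?; rewrite -exprS Qi //; lia.
have lhsR : poly_reduces (lhs_sum p m r) (\sum_(k < p) qlegendre Q a k *: 'X^k).
  apply: poly_reduces_sum => k; apply: poly_reducesZ (poly_reducesXn _).
  exact: coefR.
move=> j; apply: reduces_qcong (lhsR j) _.
rewrite (@qlegendre_expansion _ _ _ p) //; last by move=> i ?; apply: Qi; lia.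
rewrite -Qe; apply: poly_reducesZ.
  apply: reducesM (reduces_qvarz _); apply/reducesX/reducesN/reduces1.
apply: poly_reduces_sum => k; apply: poly_reducesZ.
  by rewrite exprM; apply: reducesM; [apply: coefR | do 2!apply: reducesX; apply: reduces_qvar].
exact/poly_reduces_qpochX/reducesX/reduces_qvar.
Qed.

End ResidueField.

(** * The two exponents *)

Lemma bin2_double a : 'C(a.+1, 2)%:Z * 2 = a%:Z * (a%:Z + 1).
Proof. by elim: a => [|a IH]; [rewrite bin_small | rewrite binS bin1; lia]. Qed.

Lemma exponentE m a :
  (- (m%:Z * a%:Z * (a%:Z + 1)) %/ 2)%Z = - (m%:Z * 'C(a.+1, 2)%:Z).
Proof.
by rewrite -mulrA -bin2_double mulrA -mulNr mulzK.
Qed.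

(** After multiplication by 2 m, which is prime to p, the sum becomes
    r (m - r) (1 - p^2) + (m a) (m a + m), and m a = - r modulo p makes the two
    parts cancel.  The quotient is exact: one of p - 1, p + 1 is a multiple of
    m, and the other one is even. *)
Lemma dvd_exponent_pm1 p m r a :
    prime p -> odd p -> ~~ (p %| m)%N -> (p %| r + m * a)%N ->
    (p%:Z = 1 %[mod m%:Z])%Z \/ (p%:Z = -1 %[mod m%:Z])%Z ->
  (p %| ((r%:Z * (m%:Z - r%:Z) * (1 - p%:Z ^+ 2)) %/ (2 * m%:Z))%Z
          + m%:Z * 'C(a.+1, 2)%:Z)%Z.
Proof.
move=> p_pr p_odd p_m /dvdnP[t raE] pm1.
have [h hE] : exists h, p = (2 * h + 1)%N.
  by exists p./2; rewrite -[LHS]odd_double_half p_odd mul2n addn1.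
have dvd2m : (2 * m%:Z %| 1 - p%:Z ^+ 2)%Z.
  case: pm1 => /eqP; rewrite eqz_mod_dvd => /dvdzP[s ps]; apply/dvdzP.
    exists (- s * (h%:Z + 1)); have -> : 1 - p%:Z ^+ 2 = - (p%:Z - 1) * (p%:Z + 1) by ring.
    by rewrite ps hE; ring.
  exists (- s * h%:Z); have -> : 1 - p%:Z ^+ 2 = - (p%:Z - 1) * (p%:Z - -1) by ring.
  by rewrite ps hE; ring.
have /divzK := dvdz_mull (r%:Z * (m%:Z - r%:Z)) dvd2m.
set e := (_ %/ _)%Z => eE.
have cop : coprimez p (2 * m%:Z).
  rewrite coprimezE abszM /= prime_coprime // Euclid_dvdM //.
  by rewrite negb_or p_m andbT dvdn_prime2 //; apply: contraTneq p_odd => ->.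
rewrite -(Gauss_dvdzr _ cop).
have -> : 2 * m%:Z * (e + m%:Z * 'C(a.+1, 2)%:Z) =
    e * (2 * m%:Z) + m%:Z * m%:Z * ('C(a.+1, 2)%:Z * 2) by ring.
rewrite eE bin2_double.
have maE : m%:Z * a%:Z = t%:Z * p%:Z - r%:Z.
  by rewrite -!PoszM -raE PoszD addrAC subrr add0r.
have -> : m%:Z * m%:Z * (a%:Z * (a%:Z + 1)) = (m%:Z * a%:Z) * (m%:Z * a%:Z + m%:Z) by ring.
rewrite maE; apply/dvdzP.
exists (- (r%:Z * (m%:Z - r%:Z)) * p%:Z + p%:Z * t%:Z ^+ 2 - 2 * r%:Z * t%:Z + m%:Z * t%:Z).
ring.
Qed.

(** * The congruence *)

(* Both integer divisions in the exponents are exact: a (a + 1) is even, and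
   2 m divides r (m - r) (1 - p^2) when p is odd and p = 1 or -1 modulo m. *)
Theorem theorem3p1 (p m r : nat)
    (p_prime : prime p) (p_odd : odd p) (m_gt0 : (0 < m)%N) (r_gt0 : (0 < r)%N)
    (p_ndvd_m : ~~ (p %| m)%N) :
  let a := residue p (- (r%:R / m%:R)) in
  poly_qcong (qnat p)
    (lhs_sum p m r)
    (((-1) ^+ a * qvar ^ ((- (m%:Z * a%:Z * (a%:Z + 1))) %/ 2)%Z)
       *: rhs_sum p m r)
  /\
  ((p%:Z = 1 %[mod m%:Z])%Z \/ (p%:Z = -1 %[mod m%:Z])%Z ->
   poly_qcong (qnat p)
     (lhs_sum p m r)
     (((-1) ^+ a *
       qvar ^ ((r%:Z * (m%:Z - r%:Z) * (1 - p%:Z ^+ 2)) %/ (2 * m%:Z))%Z)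
        *: rhs_sum p m r)).
Proof.
move=> a.
have [zeta zetaP] := C_prim_root_exists (prime_gt0 p_prime).
have p_ra : (p %| r + m * a)%N by apply: residueP.
have lt_ap : (a < p)%N by apply: residue_lt.
split=> [|pm1]; apply: (qlegendre_qcong p_prime zetaP) => //.
  by rewrite exponentE addNr dvdz0.
exact: dvd_exponent_pm1.
Qed.
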